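(* There is an algorithm which, given positive integers $n, m, k$ with $k > \operatorname{diam}(P_n^m)$, produces an optimal radio $k$-coloring of the graph $P_n^m$ (that is, a radio $k$-coloring of $P_n^m$ whose span equals $rc_k(P_n^m)$) in $O(n)$ time.
   Context: $P_n$ denotes the path with $n$ edges, hence $n+1$ vertices. $P_n^m$ is the graph on the same vertex set in which two distinct vertices are adjacent if and only if their distance in $P_n$ is at most $m$; equivalently, vertex set $\{0,1,\dots,n\}$ with distinct $i,j$ adjacent iff $|i-j|\le m$. $d(u,v)$ denotes graph distance and $\operatorname{diam}$ the diameter. For a positive integer $k$, a radio $k$-coloring of a graph $G$ is a function $\phi:V(G)\to\{0,1,\dots,\lambda\}$ (for some integer $\lambda\ge 0$) with $|\phi(u)-\phi(v)|\ge k+1-d(u,v)$ for all distinct $u,v\in V(G)$. Its span is its largest color. The radio $k$-chromatic number $rc_k(G)$ is the minimum span over all radio $k$-colorings of $G$. *)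

(* Defs.v *)
From mathcomp Require Import all_boot all_order all_algebra.
Set Implicit Arguments.
Unset Strict Implicit.
Unset Printing Implicit Defensive.

Section Graphs.
Variables (T : finType) (e : rel T).

(* Least length of a walk from u to v; a shortest walk has fewer than #|T|
   edges.  The value is #|T| when v cannot be reached from u. *)
Definition gdist (u v : T) : nat :=
  find (fun d => [exists p : d.-tuple T, path e u p && (last u p == v)])
       (iota 0 #|T|).

Definition diam : nat := \max_(u : T) \max_(v : T) gdist u v.

Definition graph_power (m : nat) : rel T :=
  fun u v => (u != v) && (gdist u v <= m).

(* The subtraction is truncated, which is harmless: the right-hand side is
   a natural number, so the condition is void once gdist u v > k. *)
Definition radio_coloring (k : nat) (phi : T -> nat) : bool :=
  [forall u, forall v, (u != v) ==> (k + 1 - gdist u v <= `|phi u - phi v|)].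

Definition span (phi : T -> nat) : nat := \max_(u : T) phi u.

Definition is_radio_span (k l : nat) : bool :=
  [exists phi : {ffun T -> 'I_l.+1},
    radio_coloring k (fun u => phi u) && (span (fun u => phi u) == l)].

Lemma gdist_gt0 u v : u != v -> 0 < gdist u v.
Proof.
move=> uv; rewrite /gdist; have: 0 < #|T| by apply/card_gt0P; exists u.
case: #|T| => //= n _; case: ifP => // /existsP[p].
by rewrite tuple0 /= (negbTE uv).
Qed.

Lemma ex_radio_span k : exists l, is_radio_span k l.
Proof.
pose f (u : T) : nat := k * enum_rank u.
have fP u : f u < (span f).+1 by rewrite ltnS; apply: leq_bigmax.
exists (span f); apply/existsP; exists [ffun u => Ordinal (fP u)].
apply/andP; split; last by apply/eqP/eq_bigr => u _; rewrite ffunE.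
apply/forallP => u; apply/forallP => v; apply/implyP => uv.
rewrite !ffunE /= /f -[X in X <= _]addn0 !PoszM -GRing.mulrBr abszM /=.
apply: (@leq_trans k).
  by rewrite addn0 leq_subLR addnC leq_add2r gdist_gt0.
rewrite leq_pmulr // absz_gt0 GRing.subr_eq0; apply/eqP => -[/val_inj].
by move/enum_rank_inj/eqP; rewrite (negbTE uv).
Qed.

Definition rc (k : nat) : nat := ex_minn (ex_radio_span k).

Definition optimal_radio_coloring (k : nat) (phi : T -> nat) : Prop :=
  radio_coloring k phi /\ span phi = rc k.

End Graphs.

Definition path_graph (n : nat) : rel 'I_n.+1 :=
  fun i j => (i.+1 == j :> nat) || (j.+1 == i :> nat).

Definition path_power (n m : nat) : rel 'I_n.+1 := graph_power (@path_graph n) m.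

(* Algorithms are programs of a word RAM, written with structured control flow.
   A program has finitely many registers and an indirectly addressed memory.
   Every register read, memory access, arithmetic operation, assignment and test
   takes one unit of time.  A word holds a natural number less than W; an
   expression one of whose subexpressions does not fit into a word has no value,
   and a program evaluating it is stuck. *)

Inductive binop := OAdd | OSub | OMul | ODiv | OMod | OLe | OEq.

Inductive expr :=
  | Const of nat
  | Reg of nat
  | Fetch of expr
  | Bin of binop & expr & expr.

Inductive cmd :=
  | Skip
  | Assign of nat & expr
  | Store of expr & expr
  | Seq of cmd & cmd
  | If of expr & cmd & cmd
  | While of expr & cmd.

Record state := State { regs : nat -> nat; memory : nat -> nat }.

Definition binop_eval (o : binop) (x y : nat) : nat :=
  match o with
  | OAdd => x + y
  | OSub => x - y
  | OMul => x * y
  | ODiv => x %/ y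
  | OMod => x %% y
  | OLe => x <= y
  | OEq => x == y
  end.

Definition word (W x : nat) : option nat := if x < W then Some x else None.

Fixpoint eval (W : nat) (s : state) (a : expr) : option nat :=
  match a with
  | Const x => word W x
  | Reg r => word W (regs s r)
  | Fetch b => obind (fun x => word W (memory s x)) (eval W s b)
  | Bin o b c =>
      obind (fun x => obind (fun y => word W (binop_eval o x y)) (eval W s c))
            (eval W s b)
  end.

Fixpoint cost (a : expr) : nat :=
  match a with
  | Const _ | Reg _ => 1
  | Fetch b => (cost b).+1
  | Bin _ b c => (cost b + cost c).+1
  end.

Definition set_reg (s : state) (r x : nat) : state :=
  State [eta regs s with r |-> x] (memory s).

Definition set_mem (s : state) (i x : nat) : state :=
  State (regs s) [eta memory s with i |-> x].

(* exec W p s t s': started in state s, the program p halts in state s' after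
   t units of time. *)
Inductive exec (W : nat) : cmd -> state -> nat -> state -> Prop :=
  | ExecSkip s : exec W Skip s 1 s
  | ExecAssign s r a x of eval W s a = Some x :
      exec W (Assign r a) s (cost a).+1 (set_reg s r x)
  | ExecStore s a b i x of eval W s a = Some i & eval W s b = Some x :
      exec W (Store a b) s (cost a + cost b).+1 (set_mem s i x)
  | ExecSeq p q s1 s2 s3 t u of exec W p s1 t s2 & exec W q s2 u s3 :
      exec W (Seq p q) s1 (t + u) s3
  | ExecIf a p q s s' x t of eval W s a = Some x &
      exec W (if x != 0 then p else q) s t s' :
      exec W (If a p q) s (cost a + t).+1 s'
  | ExecWhileEnd a p s of eval W s a = Some 0 :
      exec W (While a p) s (cost a).+1 s
  | ExecWhileStep a p s1 s2 s3 x t u of eval W s1 a = Some x & x != 0 &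
      exec W p s1 t s2 & exec W (While a p) s2 u s3 :
      exec W (While a p) s1 (cost a + t + u).+1 s3.

Definition input (n m k : nat) : state :=
  State [eta fun=> 0 with 0 |-> n, 1 |-> m, 2 |-> k] (fun=> 0).

(* Main.v *)
(* Distances in P_n^m are ceil(|u - v| / m), so d(u, v) <= L u + L v + 1, where
   L is the distance to a fixed window of m + 1 consecutive vertices.  Adding the
   coloring conditions for vertices with successive colors gives
   span >= n k - 2 \sum_v L v.  When two neighbouring windows have the same sum,
   equality would force the difference of the two potentials to vanish at the
   first vertex and to change sign at every step, hence to vanish everywhere,
   which it does not; so the span is at least one larger.  An ordering of the
   vertices which attains these bounds splits into classes modulo m, within
   which the two sides of the window alternate; as k > diam, the conditions for
   vertices which are not consecutive in it follow from those for consecutive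
   ones, up to few cases.  The color of a vertex is then an arithmetic
   expression in n, m, k and the vertex, evaluated in constant time, and its
   intermediate values are bounded by a power of n + m + k. *)
Require Import Defs.
From mathcomp Require Import all_boot all_order all_algebra.
From mathcomp Require Import zify.

Set Implicit Arguments.
Unset Strict Implicit.
Unset Printing Implicit Defensive.

(** * Distances *)

(** The ceiling of [|u - v| / m]: one of the two truncated differences is zero. *)
Definition steps (m u v : nat) : nat := ((u - v) + (v - u) + m.-1) %/ m.

Lemma steps_le m u v d : 0 < m ->
  (steps m u v <= d) = (u <= v + d * m) && (v <= u + d * m).
Proof.
move=> m0; rewrite /steps -ltnS ltn_divLR // mulSn.
by case: leqP => h; case: leqP; case: leqP => //=; lia.
Qed.

Lemma leq_steps m u v d : 0 < m ->
  (u + d * m < v) || (v + d * m < u) -> d < steps m u v.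
Proof.
by move=> m0 h; rewrite ltnNge steps_le // negb_and -!ltnNge orbC.
Qed.

Lemma steps_gt0 m u v : 0 < m -> u != v -> 0 < steps m u v.
Proof. by move=> m0 uv; apply: leq_steps => //; lia. Qed.

Lemma gdistE (T : finType) (e : rel T) u v p :
    path e u p -> last u p = v -> size p < #|T| ->
    (forall p', path e u p' -> last u p' = v -> size p <= size p') ->
  gdist e u v = size p.
Proof.
move=> ep lp sp min_p; rewrite /gdist.
set a := fun d => _.
have ap : a (size p) by apply/existsP; exists (in_tuple p); rewrite ep lp eqxx.
have hs : has a (iota 0 #|T|).
  by apply/hasP; exists (size p); rewrite ?mem_iota.
have fT : find a (iota 0 #|T|) < #|T|.
  by rewrite -[X in _ < X](size_iota 0) -has_find.
apply/eqP; rewrite eqn_leq; apply/andP; split.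
  rewrite leqNgt; apply/negP => h; have := before_find 0 h.
  by rewrite nth_iota // add0n ap.
have := nth_find 0 hs; rewrite nth_iota // => /existsP[p' /andP[ep' /eqP lp']].
by rewrite add0n in p' ep' lp'; rewrite -(size_tuple p') min_p.
Qed.

Section BandGraph.
Variables (n m : nat) (e : rel 'I_n.+1).
Hypothesis m_gt0 : 0 < m.
Hypothesis eE : forall u v, e u v = (u != v) && (steps m u v <= 1).

Lemma band_walk_le u p : path e u p -> steps m u (last u p) <= size p.
Proof.
elim: p u => [|v p IH] u /=; first by rewrite steps_le //; lia.
case/andP; rewrite eE => /andP[_ uv] /IH; move: uv; rewrite !steps_le //; lia.
Qed.

Lemma band_walk u v :
  exists p, [/\ path e u p, last u p = v & size p = steps m u v].
Proof.
move: {2}(steps m u v) (erefl (steps m u v)) => d.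
elim: d u => [|d IH] u Hd.
  exists [::]; split => //=; apply/eqP/negPn/negP => uv.
  by have := steps_gt0 m_gt0 uv; rewrite Hd.
(* Greedy walk: jump [m] towards [v], or land on [v] if it is nearer. *)
pose w := if u < v then minn (u + m) v else maxn (u - m) v.
have wn : w < n.+1.
  by rewrite /w; have := ltn_ord u; have := ltn_ord v; case: (ltnP u v); lia.
have h1 : steps m u v <= d.+1 by rewrite Hd.
have h2 : ~~ (steps m u v <= d) by rewrite Hd; lia.
have hw : steps m w v = d.
  apply/eqP; rewrite eqn_leq; apply/andP; split.
    rewrite steps_le // /w; move: h1; rewrite steps_le // mulSn.
    by case: (ltnP u v); lia.
  case: d {IH Hd} h1 h2 => [|d] h1 h2 //.
  apply: leq_steps => //; rewrite /w; move: h2; rewrite steps_le // mulSn.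
  by case: (ltnP u v); lia.
have [p [ep lp sp]] := IH (Ordinal wn) hw.
exists (Ordinal wn :: p); split => //=; last by rewrite sp /= hw Hd.
rewrite ep eE steps_le // andbT; apply/andP; split; last first.
  by rewrite /= /w; case: (ltnP u v); lia.
apply/eqP => uw; have uw' : u = w :> nat by rewrite [in LHS]uw.
by move: Hd; rewrite uw' hw; lia.
Qed.

Lemma gdist_band u v : gdist e u v = steps m u v.
Proof.
have [p [ep lp sp]] := band_walk u v; rewrite -sp; apply: gdistE => //.
  rewrite card_ord sp ltnS; have := ltn_ord u; have := ltn_ord v.
  rewrite steps_le // => *; nia.
by move=> p' ep' lp'; rewrite sp -lp' band_walk_le.
Qed.

End BandGraph.

Lemma gdist_path_graph n u v : gdist (@path_graph n) u v = steps 1 u v.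
Proof.
apply: gdist_band => // {u v} u v.
by rewrite /path_graph steps_le // -val_eqE /=; lia.
Qed.

Lemma gdist_path_power n m u v :
  0 < m -> gdist (@path_power n m) u v = steps m u v.
Proof.
move=> m0; apply: gdist_band => // {u v} u v.
rewrite /path_power /graph_power gdist_path_graph; congr (_ && _).
by rewrite !steps_le //; lia.
Qed.

Lemma steps_minn n m u v : 0 < m -> 0 < n -> u <= n -> v <= n ->
  steps m u v = steps (minn m n) u v.
Proof.
move=> m0 n0 un vn; case: (leqP m n) => mn //.
apply/eqP; rewrite eqn_leq; apply/andP; split.
  by rewrite steps_le //; have := leqnn (steps n u v); rewrite steps_le //; nia.
rewrite steps_le //; have := leqnn (steps m u v); rewrite steps_le //.
by case: (steps m u v) => [|d]; rewrite ?mulSn; lia.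
Qed.

(** * Lower bound *)

(* The distance in steps from v to the window [l, l + m] (for v = l the
   subtraction truncates, giving 0). *)
Definition lev (m l v : nat) : nat :=
  if v < l then (l - 1 - v) %/ m + 1 else (v - l - 1) %/ m.

(** A vertex of level [j] lies within [j * m] of the window, whose ends are [m] apart. *)
Lemma steps_lev m l u v : 0 < m -> steps m u v <= lev m l u + lev m l v + 1.
Proof.
move=> m0.
have lt_mul x : x < (x %/ m) * m + m by rewrite addnC -mulSn ltn_ceil.
rewrite steps_le // /lev.
have := lt_mul (l - 1 - u); have := lt_mul (l - 1 - v).
have := lt_mul (u - l - 1); have := lt_mul (v - l - 1).
move: (_ %/ m) (_ %/ m) (_ %/ m) (_ %/ m) => a b c d.
by case: (ltnP u l) => ul; case: (ltnP v l) => vl; rewrite !mulnDl !mul1n; lia.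
Qed.

Lemma sum_lev m l n : l <= n ->
  \sum_(v < n.+1) lev m l v =
    l + \sum_(i < l) i %/ m + \sum_(i < n - l) i %/ m.
Proof.
move=> ln; rewrite -!(big_mkord xpredT (lev m l)).
rewrite (@big_cat_nat _ _ _ l) //=; last by lia.
congr (_ + _).
  rewrite big_mkord -[in RHS](big_mkord xpredT (fun i => i %/ m)).
  rewrite big_nat_rev /= big_mkord.
  rewrite -[X in X + _](card_ord l) -sum1_card -big_split /=.
  apply: eq_bigr => i _; rewrite /lev ltn_ord addnC; congr (_ + _ %/ _).
  by have := ltn_ord i; lia.
rewrite -{1}[l]add0n big_addn subSn // big_mkord big_ord_recl /=.
rewrite /lev add0n ltnn subnn sub0n div0n add0n.
apply: eq_bigr => i _; rewrite /bump /=.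
by rewrite ltnNge leq_addl /=; congr (_ %/ _); lia.
Qed.

(** The sum is [m a (a - 1) / 2 + a b], freed of division and subtraction; [b = m] is allowed
    because [s = m] can occur. *)
Lemma sum_divn m a b : b <= m ->
  2 * (\sum_(i < a * m + b) i %/ m) + m * a = m * (a * a) + 2 * (a * b).
Proof.
move=> bm.
have row a' b' : b' <= m -> \sum_(i < a' * m + b') i %/ m =
    \sum_(i < a' * m) i %/ m + a' * b'.
  elim: b' => [|b' IH] h; first by rewrite muln0 !addn0.
  rewrite addnS big_ord_recr /= IH 1?ltnW // divnMDl; last by lia.
  by rewrite (divn_small h) addn0 mulnSr addnA.
rewrite row //; elim: a => [|a IH]; first by rewrite mul0n big_ord0; lia.
rewrite [a.+1 * m]mulSnr row //; move: IH; set S := \sum_(i < _) _ => IH.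
nia.
Qed.

Section LowerBound.
Variables (T : finType) (e : rel T) (k : nat) (phi : T -> nat).
Hypothesis phiP : radio_coloring e k phi.

Definition by_color : seq T := sort (fun u v => phi u <= phi v) (enum T).

Lemma by_color_sorted :
  sorted (fun u v => phi u + k + 1 <= phi v + gdist e u v) by_color.
Proof.
have: sorted (fun u v => (phi u <= phi v) && (u != v)) by_color.
  apply: pairwise_sorted; rewrite (pairwise_relI (fun u v => phi u <= phi v)).
  rewrite -sorted_pairwise; last by move=> u v w; apply: leq_trans.
  by rewrite sort_sorted -?uniq_pairwise ?sort_uniq ?enum_uniq // => u v;
    apply: leq_total.
apply: sub_sorted => u v /andP[uv nuv].
move/forallP: phiP => /(_ u) /forallP /(_ v); rewrite nuv /=.
by lia.
Qed.

Lemma span_ge u : phi u <= Defs.span phi.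
Proof. exact: leq_bigmax. Qed.

Section Potential.
Variable L : T -> nat.
Hypothesis gdist_le : forall u v, gdist e u v <= L u + L v + 1.

(** Adding up the steps counts inner vertices twice but the two ends once, hence the end terms on
    the left. *)
Lemma path_color_ge u s :
  path (fun u v => phi u + k + 1 <= phi v + gdist e u v) u s ->
  phi u + size s * k + L u + L (last u s) <=
    phi (last u s) + 2 * \sum_(v <- u :: s) L v.
Proof.
elim: s u => [|v s IH] u /=; first by rewrite big_seq1; lia.
case/andP=> uv /IH; rewrite (big_cons _ _ u) [_.+1 * k]mulSn.
have := gdist_le u v.
move: (\sum_(_ <- _) _) (size s * k) => S K; lia.
Qed.

Lemma span_potential : #|T|.-1 * k <= Defs.span phi + 2 * \sum_v L v.
Proof.
have := by_color_sorted.
have sz := size_sort (fun u v => phi u <= phi v) (enum T).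
have pm : perm_eq by_color (index_enum T).
  by rewrite /by_color perm_sort enumT.
rewrite -(perm_big _ pm) cardE -sz /= -/by_color.
case: by_color => [|u s] /=; first by lia.
by move/path_color_ge; have := span_ge (last u s); lia.
Qed.

End Potential.

Section TwoPotentials.
Variables L1 L2 : T -> nat.
Hypothesis gdist_le1 : forall u v, gdist e u v <= L1 u + L1 v + 1.
Hypothesis gdist_le2 : forall u v, gdist e u v <= L2 u + L2 v + 1.

(* If no step of the path loses anything against either potential, the
   difference of the potentials changes sign at every step. *)
Lemma path_tight u s :
  path (fun u v => phi u + k + 1 <= phi v + gdist e u v) u s ->
  phi (last u s) + 2 * \sum_(v <- u :: s) L1 v <=
    phi u + size s * k + L1 u + L1 (last u s) ->
  phi (last u s) + 2 * \sum_(v <- u :: s) L2 v <=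
    phi u + size s * k + L2 u + L2 (last u s) ->
  L1 u = L2 u -> forall v, v \in u :: s -> L1 v = L2 v.
Proof.
elim: s u => [|w s IH] u /=; first by move=> _ _ _ h v; rewrite inE => /eqP->.
case/andP=> uw pws; rewrite !(big_cons _ _ u) => t1 t2 h v.
have := path_color_ge gdist_le1 pws; have := path_color_ge gdist_le2 pws.
have := gdist_le1 u w; have := gdist_le2 u w => g1 g2 g3 g4.
rewrite inE => /orP[/eqP->//|]; apply: IH => //; lia.
Qed.

Lemma span_two_potentials v0 : L1 v0 != L2 v0 -> \sum_v L1 v = \sum_v L2 v ->
  #|T|.-1 * k < Defs.span phi + 2 * \sum_v L1 v.
Proof.
move=> v0P eqL; rewrite ltnNge; apply/negP => h2; have := h2; rewrite eqL => h3.
have := by_color_sorted.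
have sz := size_sort (fun u v => phi u <= phi v) (enum T).
have pm : perm_eq by_color (index_enum T).
  by rewrite /by_color perm_sort enumT.
have : v0 \in by_color by rewrite mem_sort mem_enum.
move: h2 h3; rewrite -!(perm_big _ pm) cardE -sz /= -/by_color.
case: by_color => [|u s] //= h1 h2 v0s ps.
(* Under the assumed bound these inequalities are tight and force [L1 u = L2 u = 0]. *)
have := path_color_ge gdist_le1 ps; have := path_color_ge gdist_le2 ps.
have := span_ge (last u s) => h g2 g1.
by case/eqP: v0P; apply: path_tight ps _ _ _ _ v0s; lia.
Qed.

End TwoPotentials.
End LowerBound.

(** * The coloring *)

(* With the window [l, l + m] fixed, the vertices below l form m classes
   l + y - j m (j > 0) and the vertices above l form m classes l + 1 + y + i m
   (i >= 0), for y < m.  The class y has p vertices below l if s <= y and q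
   otherwise, and p vertices above l if s <= y and q + 1 otherwise.  The two
   constructors are the parities of the diameter. *)
Inductive layout (n m p q s l : nat) : Prop :=
| LayoutOdd of 0 < s <= m & n = 2 * (p * m) + s & l = p * m & q = p
| LayoutEven of s < m & p = q.+1 & n = p * m + l & l = q * m + (m - s).

(* The classes are colored one after the other: first y = s, ..., m - 1 (with p
   vertices on both sides), then y = s - 1, ..., 0 (q below, q + 1 above), and
   last the vertex l.  Within a class the vertices above and below l alternate,
   each side in increasing order, starting above; so the distances between
   successive vertices are alternately T + 1 and T + 2, where T is p or q.  The
   color steps are k + 1 minus these distances, and [stride] is two of them. *)
Definition stride (k T : nat) := 2 * (k - T) - 1.
Definition asc_len (k p : nat) := 2 * p * (k - p).
Definition desc_len (k q : nat) := q * stride k q + (k - q).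
Definition desc_start (m k p s : nat) := asc_len k p * (m - s) + (s < m).

Definition block_height (p q s y : nat) := if s <= y then p else q.
Definition block_start (m k p q s y : nat) :=
  if s <= y then asc_len k p * (y - s)
  else desc_start m k p s + (s - 1 - y) * desc_len k q.

(** Below [l], [v = l + y - j * m] gives [x = (j - 1) * m + (m - 1 - y)], so [v] has index
    [T - j = T - 1 - x %/ m] from the bottom of its class. *)
Definition color (m k p q s l v : nat) : nat :=
  if v < l then
    let x := l - 1 - v in
    let y := m - 1 - x %% m in
    let T := block_height p q s y in
    block_start m k p q s y + (T - 1 - x %/ m) * stride k T + (k - T)
  else if v == l then desc_start m k p s + s * desc_len k q
  else
    let x := v - l - 1 in
    let y := x %% m in
    block_start m k p q s y + (x %/ m) * stride k (block_height p q s y).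

(** * Color gaps within a class and between successive classes *)

Section Blocks.
Variables m k T : nat.
Hypothesis k_gt : 2 * T < k.

(* The N vertices (w - x) + i m and the T vertices (w - x - 1) - (T - i) m,
   taken alternately in increasing order, and the offsets of their colors. *)
Variant in_block (N x w v d : nat) : Prop :=
| InUpper i of i < N & v + x = w + i * m & d = i * stride k T
| InLower i of i < T & v + T * m + x + 1 = w + i * m
    & d = i * stride k T + (k - T).

Lemma stride_ge : k <= stride k T.
Proof. by rewrite /stride; lia. Qed.

Lemma lt_stride i j : i < j -> i * stride k T + stride k T <= j * stride k T.
Proof. by move=> ij; rewrite -mulSnr leq_mul2r ij orbT. Qed.

Lemma le_stride i j : i <= j -> i * stride k T <= j * stride k T.
Proof. by move=> ij; rewrite leq_mul2r ij orbT. Qed.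

Lemma strideE : stride k T + 1 = 2 * (k - T).
Proof. by rewrite /stride; lia. Qed.

Lemma asc_lenE : asc_len k T = T * stride k T + T.
Proof. by rewrite /asc_len /stride; nia. Qed.

(** Attained by the last lower vertex, which leaves a gap of only [k - 1] before the next class. *)
Lemma asc_block_le x w v d : in_block T x w v d -> d + k <= asc_len k T + 1.
Proof.
have gk := stride_ge; have gE := strideE; rewrite asc_lenE.
by case=> i /lt_stride h _ ->; lia.
Qed.

Lemma desc_block_le x w v d :
  in_block T.+1 x w v d -> d + (k - T) <= desc_len k T.
Proof.
have gk := stride_ge; have gE := strideE; rewrite /desc_len.
by case=> i; [rewrite ltnS => /le_stride|move/lt_stride] => h _ ->; lia.
Qed.

Hypothesis m_gt0 : 0 < m.

(** As [2 * T < k], a stride is at least [k]. Only neighbours in the alternating order need a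
    distance above 1; theirs is [T + 1] from upper to lower and [T + 2] from lower to upper. *)
Lemma block_sep N x w v d v' d' : in_block N x w v d -> in_block N x w v' d' ->
  v != v' -> d <= d' -> d + k + 1 <= d' + steps m v v'.
Proof.
have gk := stride_ge; have gE := strideE.
case=> i iN vE dE [] j jN vE' dE' nvv' dd'; have s0 := steps_gt0 m_gt0 nvv'.
- have := @lt_stride i j; case: (ltngtP i j) => [ij|ji|ij] h.
  + by have := h isT; lia.
  + by have := lt_stride ji; lia.
  + by subst j; lia.
- case: (ltngtP i j) => [ij|ji|ij].
  + by have := lt_stride ij; lia.
  + by have := lt_stride ji; lia.
  + subst j; suff : T < steps m v v' by lia.
    by apply: leq_steps => //; lia.
- case: (ltngtP i.+1 j) => [ij|ji|ij].
  + by have := lt_stride ij; have := @lt_stride i i.+1 (leqnn _); lia.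
  + by have := @le_stride j i; lia.
  + subst j; suff : T.+1 < steps m v v'.
      by have := @lt_stride i i.+1 (leqnn _); lia.
    by apply: leq_steps => //; rewrite mulSn in vE' *; lia.
- case: (ltngtP i j) => [ij|ji|ij]; first by have := lt_stride ij; lia.
    by have := @lt_stride j i ji; lia.
  by subst j; lia.
Qed.

Lemma asc_block_next w v d v' d' : in_block T 0 w v d ->
  in_block T 0 w.+1 v' d' -> v != v' ->
  d + k + 1 <= asc_len k T + d' + steps m v v'.
Proof.
have gk := stride_ge; have gE := strideE; rewrite asc_lenE => vB v'B nvv'.
have s0 := steps_gt0 m_gt0 nvv'.
case: vB => i iT vE ->; first by have := lt_stride iT; lia.
case: (ltngtP i.+1 T) => [ij|ji|ij]; last 1 first.
- have hT : T * stride k T = i * stride k T + stride k T by rewrite -ij mulSnr.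
  case: v'B => [] [|j] jT v'E ->; last 2 first.
  + by lia.
  + by lia.
  (* Here [v' - v = m + 2], so the two steps make up for the color gap [k - 1]. *)
  + suff : 1 < steps m v v' by lia.
    by apply: leq_steps => //; rewrite -ij mulSnr in vE; lia.
  + by have := @lt_stride 0 j.+1 isT; lia.
- by have := lt_stride ij; rewrite mulSnr; lia.
- by lia.
Qed.

(** The critical pair is the last upper vertex and the first one of the next class: they are
    [T * m + 1] apart, with color gap [k - T]. *)
Lemma desc_block_next x w v d v' d' : in_block T.+1 x w v d ->
  in_block T.+1 x.+1 w v' d' -> v != v' ->
  d + k + 1 <= desc_len k T + d' + steps m v v'.
Proof.
have gk := stride_ge; have gE := strideE; rewrite /desc_len => vB v'B nvv'.
have s0 := steps_gt0 m_gt0 nvv'.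
case: vB => i iT vE ->; last by have := lt_stride iT; lia.
move: iT; rewrite ltnS leq_eqVlt => /orP[/eqP iT|/lt_stride]; last by lia.
subst i; case: v'B => [] [|j] jT v'E ->; last 2 first.
- by lia.
- by lia.
- suff : T < steps m v v' by lia.
  by apply: leq_steps => //; lia.
- by have := @lt_stride 0 j.+1 isT; lia.
Qed.

End Blocks.

(** * Validity and optimality of the coloring *)

Section Layout.
Variables n m k p q s l : nat.
Hypothesis m_gt0 : 0 < m.
Hypothesis lay : layout n m p q s l.
Hypothesis k_gt : 2 * p < k.

Lemma layout_le : s <= m /\ q <= p.
Proof. by case: lay => *; lia. Qed.

(** [Desc] numbers the classes downwards, [t = s - 1 - y]; the vertex [l] alone fills a fictitious
    last class [t = s]. *)
Variant slot (v c : nat) : Prop :=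
| Asc t d of t < m - s & in_block m k p p 0 (l + 1 + s + t) v d
    & c = asc_len k p * t + d
| Desc t d of t <= s & in_block m k q q.+1 t (l + s) v d & (t = s -> d = 0)
    & c = desc_start m k p s + t * desc_len k q + d.

Lemma color_slot v : v <= n -> slot v (color m k p q s l v).
Proof.
move=> vn; have [sm qp] := layout_le; rewrite /color.
case: ltnP => vl.
  set x := l - 1 - v; have xE := divn_eq x m; have xm := ltn_pmod x m_gt0.
  have vx : v + x + 1 = l by rewrite /x; lia.
  clearbody x; move: xE xm; move: (x %/ m) (x %% m) => a b xE xm.
  rewrite /block_height /block_start; case: leqP => sy; rewrite -addnA.
    have ap : a < p by case: lay => *; subst; nia.
    apply: (Asc _ _ (erefl _)); first by lia.
    apply: (@InLower _ _ _ _ _ _ _ _ (p - 1 - a)) => //; first by lia.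
    by rewrite !mulnBl mul1n; have := leq_mul ap (leqnn m); lia.
  have aq : a < q by case: lay => *; subst; nia.
  apply: (Desc _ _ _ (erefl _)); [by lia| |by lia].
  apply: (@InLower _ _ _ _ _ _ _ _ (q - 1 - a)) => //; first by lia.
  by rewrite !mulnBl mul1n; have := leq_mul aq (leqnn m); lia.
case: eqP => [->|vl'].
  rewrite -[X in slot _ X]addn0; apply: (Desc _ _ _ (erefl _)) => //.
  by apply: (@InUpper _ _ _ _ _ _ _ _ 0); rewrite ?addn0.
set x := v - l - 1; have xE := divn_eq x m; have xm := ltn_pmod x m_gt0.
have vx : v = l + x + 1 by rewrite /x; lia.
clearbody x; move: xE xm; move: (x %/ m) (x %% m) => a b xE xm.
rewrite /block_height /block_start; case: leqP => sy.
  apply: (Asc _ _ (erefl _)); first by lia.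
  apply: (@InUpper _ _ _ _ _ _ _ _ a) => //; last by lia.
  by case: lay => *; subst; nia.
apply: (Desc _ _ _ (erefl _)); [by lia| |by lia].
apply: (@InUpper _ _ _ _ _ _ _ _ a) => //; last by lia.
by case: lay => *; subst; nia.
Qed.

Lemma slot_sep u cu v cv : slot u cu -> slot v cv -> u != v ->
  cu + k + 1 <= cv + steps m u v \/ cv + k + 1 <= cu + steps m v u.
Proof.
have [sm qp] := layout_le; have kq : 2 * q < k by lia.
move=> uS vS nuv; have nvu : v != u by rewrite eq_sym.
have s0 := steps_gt0 m_gt0 nuv; have s0' := steps_gt0 m_gt0 nvu.
have asc_desc t d w x y t' d' : t < m - s -> in_block m k p p x w y d ->
    (* The extra unit in [desc_start] widens the gap after the last ascending class from [k - 1] to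
       [k]. *)
    asc_len k p * t + d + k <= desc_start m k p s + t' * desc_len k q + d'.
  move=> tm B; have := asc_block_le k_gt B.
  rewrite /desc_start; have -> : s < m by lia.
  have := leq_mul (leqnn (asc_len k p)) tm; rewrite mulnS; lia.
have asc_asc t d t' d' y y' : t < t' -> y != y' ->
    in_block m k p p 0 (l + 1 + s + t) y d ->
    in_block m k p p 0 (l + 1 + s + t') y' d' ->
    asc_len k p * t + d + k + 1 <= asc_len k p * t' + d' + steps m y y'.
  move=> tt' nyy' B B'; have s1 := steps_gt0 m_gt0 nyy'.
  move: tt'; rewrite leq_eqVlt => /orP[/eqP tt'|tt'].
    rewrite -tt' addnS in B'; have := asc_block_next k_gt m_gt0 B B' nyy'.
    by rewrite -tt' mulnS; lia.
  have := asc_block_le k_gt B.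
  have := leq_mul (leqnn (asc_len k p)) tt'; rewrite !mulnS.
  suff : 0 < asc_len k p by lia.
  by rewrite (asc_lenE k_gt) addn_gt0; case: B => i ip *; lia.
have desc_desc t d t' d' y y' : t < t' -> y != y' ->
    in_block m k q q.+1 t (l + s) y d ->
    in_block m k q q.+1 t' (l + s) y' d' ->
    t * desc_len k q + d + k + 1 <= t' * desc_len k q + d' + steps m y y'.
  move=> tt' nyy' B B'; have s1 := steps_gt0 m_gt0 nyy'.
  move: tt'; rewrite leq_eqVlt => /orP[/eqP tt'|tt'].
    rewrite -tt' in B'; have := desc_block_next kq m_gt0 B B' nyy'.
    by rewrite -tt' mulSn; lia.
  have := desc_block_le kq B.
  have := leq_mul tt' (leqnn (desc_len k q)); rewrite !mulSn.
  suff : q <= desc_len k q by lia.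
  by rewrite /desc_len; lia.
case: uS => t d tm B; [move=> ->|move=> dE ->];
  case: vS => t' d' tm' B'; [move=> ->|move=> dE' ->|move=> ->|move=> dE' ->].
- case: (ltngtP t t') => [tt'|tt'|tt'].
  + by left; apply: asc_asc B B'.
  + by right; apply: asc_asc B' B.
  + subst t'; case/orP: (leq_total d d') => dd'.
      by left; have := block_sep k_gt m_gt0 B B' nuv dd'; lia.
    by right; have := block_sep k_gt m_gt0 B' B nvu dd'; lia.
- by left; have := asc_desc t d _ _ _ t' d' tm B; lia.
- by right; have := asc_desc t' d' _ _ _ t d tm' B'; lia.
- case: (ltngtP t t') => [tt'|tt'|tt'].
  + by left; have := desc_desc _ _ _ _ _ _ tt' nuv B B'; lia.
  + by right; have := desc_desc _ _ _ _ _ _ tt' nvu B' B; lia.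
  + subst t'; case/orP: (leq_total d d') => dd'.
      by left; have := block_sep kq m_gt0 B B' nuv dd'; lia.
    by right; have := block_sep kq m_gt0 B' B nvu dd'; lia.
Qed.

Lemma slot_le v c :
  slot v c -> c <= desc_start m k p s + s * desc_len k q.
Proof.
have [sm qp] := layout_le; have kq : 2 * q < k by lia.
case=> [t d tm B ->|t d].
  have := asc_block_le k_gt B; rewrite /desc_start.
  by have := leq_mul (leqnn (asc_len k p)) tm; rewrite mulnS; lia.
rewrite leq_eqVlt => /orP[/eqP -> _ /(_ erefl) -> ->|ts B _ ->]; first by lia.
have := desc_block_le kq B.
by have := leq_mul ts (leqnn (desc_len k q)); rewrite mulSn; lia.
Qed.

Variable e : rel 'I_n.+1.
Hypothesis gdist_e : forall u v, gdist e u v = steps m u v.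

Lemma color_radio :
  radio_coloring e k (fun v : 'I_n.+1 => color m k p q s l v).
Proof.
apply/forallP => u; apply/forallP => v; apply/implyP => nuv.
rewrite gdist_e.
have Su := color_slot (ltn_ord u : u <= n).
have Sv := color_slot (ltn_ord v : v <= n).
have stepsC : steps m v u = steps m u v.
  by rewrite /steps addnC [v - u + _]addnC addnC.
by have := slot_sep Su Sv nuv; rewrite stepsC; lia.
Qed.

Lemma span_color :
  Defs.span (fun v : 'I_n.+1 => color m k p q s l v) <=
    desc_start m k p s + s * desc_len k q.
Proof.
apply/bigmax_leqP => v _; apply: slot_le.
exact: color_slot (ltn_ord v : v <= n).
Qed.

(** Matches the top color with the lower bound; the 1 for [s < m] is the gain from two
    potentials. *)
Lemma color_top_sum_lev :
  desc_start m k p s + s * desc_len k q + 2 * \sum_(v < n.+1) lev m l v =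
    n * k + (s < m).
Proof.
have [sm qp] := layout_le.
(* Writing [m = s + r] and [k = p + c + 1] removes truncated subtractions before [nia]. *)
have [r mE] : exists r, m = s + r by exists (m - s); lia.
rewrite sum_lev; last by case: lay => *; lia.
rewrite /desc_start /asc_len /desc_len /stride.
have [c kE] : exists c, k = p + c.+1 by exists (k - p.+1); lia.
case: lay => [/andP[s0 _] nE lE qE|sm' pE nE lE].
  have := sum_divn p (leq0n m); have := sum_divn p sm.
  have -> : p * m + s = n - l by lia.
  have -> : p * m + 0 = l by lia.
  move: (\sum_(i < l) _) (\sum_(i < n - l) _) => S1 S2 E2 E1.
  have -> : k - p = c.+1 by lia.
  rewrite qE; have -> : k - p = c.+1 by lia.
  have -> : m - s = r by lia.
  have -> : 2 * c.+1 - 1 = 2 * c + 1 by lia.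
  move: E1 E2; rewrite nE kE lE mE; nia.
have ms : m - s <= m by lia.
have := sum_divn p (leq0n m); have := sum_divn q ms.
have -> : p * m + 0 = n - l by lia.
have -> : q * m + (m - s) = l by lia.
move: (\sum_(i < l) _) (\sum_(i < n - l) _) => S1 S2 E1 E2.
have kq : k - q = c + 2 by lia.
have -> : k - p = c.+1 by lia.
rewrite kq; have rE : m - s = r by lia.
rewrite rE in lE *.
have -> : 2 * (c + 2) - 1 = 2 * c + 3 by lia.
rewrite rE in E1; move: E1 E2; rewrite nE kE lE mE pE; nia.
Qed.

Hypothesis m_le : m <= n.

(** Moving the window down by one trades the term [l.-1 %/ m + 1] for [(n - l) %/ m], and these
    agree in both layouts. *)
Lemma shifted_core : s < m ->
  0 < l /\ \sum_(v < n.+1) lev m l v = \sum_(v < n.+1) lev m l.-1 v.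
Proof.
move=> sm.
have [l0 eqL] : 0 < l /\ (l.-1 %/ m).+1 = (n - l) %/ m.
  case: lay => [/andP[s0 _] nE lE qE|_ pE nE lE].
    have p0 : 0 < p by case: (p) nE => //; lia.
    have -> : n - l = p * m + s by lia.
    have -> : l.-1 = p.-1 * m + m.-1.
      by rewrite lE -[in LHS](prednK p0) mulSn; lia.
    by rewrite !divnMDl // !divn_small //; lia.
  have -> : n - l = p * m + 0 by lia.
  have -> : l.-1 = q * m + (m - s).-1 by lia.
  by rewrite !divnMDl // !divn_small //; lia.
have ln : l <= n by case: lay => *; lia.
split=> //; rewrite !sum_lev //; last by lia.
have -> : n - l.-1 = (n - l).+1 by lia.
rewrite big_ord_recr /= -eqL; case: (l) l0 => // l' _ /=.
by rewrite big_ord_recr /=; lia.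
Qed.

Lemma color_top_le phi : radio_coloring e k phi ->
  desc_start m k p s + s * desc_len k q <= Defs.span phi.
Proof.
move=> phiP; have := color_top_sum_lev.
have gle l' (u v : 'I_n.+1) :
    gdist e u v <= lev m l' u + lev m l' v + 1.
  by rewrite gdist_e steps_lev.
case: ltnP => sm; last first.
  by have := span_potential phiP (gle l); rewrite card_ord /=; lia.
have [l0 eqL] := shifted_core sm.
have ln : l.-1 < n.+1 by case: lay => *; lia.
have := span_two_potentials phiP (gle l) (gle l.-1) (v0 := Ordinal ln) _ eqL.
(* The potentials differ at [l.-1], which has level 1 for one window and 0 for the other. *)
rewrite card_ord /= => h; suff /h : lev m l l.-1 != lev m l.-1 l.-1 by lia.
by rewrite /lev ltnn !(subnn, sub0n, div0n) prednK // leqnn addn1.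
Qed.

Lemma color_optimal :
  optimal_radio_coloring e k (fun v : 'I_n.+1 => color m k p q s l v).
Proof.
split; first exact: color_radio.
set phi := fun _ => _; rewrite /rc.
case: ex_minnP => r /existsP[psi /andP[psiP /eqP <-]] min_r.
apply/eqP; rewrite eqn_leq (leq_trans span_color) ?color_top_le //=.
apply: min_r; apply/existsP.
have phi_le u : phi u < (Defs.span phi).+1 by rewrite ltnS span_ge.
exists [ffun u => Ordinal (phi_le u)]; apply/andP; split.
  have := color_radio => /forallP h; apply/forallP => u; apply/forallP => v.
  by rewrite !ffunE /=; have /forallP := h u.
by apply/eqP; apply: eq_bigr => u _; rewrite ffunE.
Qed.

End Layout.

(* 2 p m is the multiple of 2 m nearest to n, and s is the distance to it. *)
Definition half_blocks (n m : nat) := (n + m - 1) %/ (2 * m).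
Definition short_classes (n m : nat) :=
  (n - 2 * m * half_blocks n m) + (2 * m * half_blocks n m - n).
Definition short_height (n m : nat) :=
  half_blocks n m - (n <= 2 * m * half_blocks n m).
Definition center (n m : nat) := (n - short_classes n m) %/ 2.

Lemma layoutP n m : 0 < m -> m <= n ->
  layout n m (half_blocks n m) (short_height n m) (short_classes n m)
    (center n m).
Proof.
move=> m0 mn; rewrite /center /short_height /short_classes /half_blocks.
have := divn_eq (n + m - 1) (2 * m).
have : (n + m - 1) %% (2 * m) < 2 * m by rewrite ltn_mod; lia.
move: (_ %/ _) (_ %% _) => p r rm nE.
have pm : p * (2 * m) = 2 * (p * m) by lia.
have mp : 2 * m * p = 2 * (p * m) by lia.
rewrite mp {mp}; rewrite pm {pm} in nE.
(* [n <= 2 * (p * m)] gives the even layout; the tie [n = 2 * (p * m) + m] is rounded down and gives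
   the odd one with [s = m]. *)
case: leqP => np.
  case: p np nE => [|p] np nE; first by lia.
  rewrite mulSn in np nE *.
  by apply: LayoutEven; rewrite ?subn1 /= ?mulSn; lia.
by apply: LayoutOdd; lia.
Qed.

(** The end vertices [0] and [n] are already at distance at least [2 * half_blocks n m]. *)
Lemma diam_gt_blocks n m k (e : rel 'I_n.+1) :
    (forall u v, gdist e u v = steps m u v) ->
  0 < m -> m <= n -> diam e < k ->
  2 * half_blocks n m < k.
Proof.
move=> gdist_e m0 mn; apply: leq_ltn_trans.
apply: leq_trans (leq_bigmax (ord0 : 'I_n.+1)).
apply: leq_trans (leq_bigmax (ord_max : 'I_n.+1)).
rewrite gdist_e /=; case: (layoutP m0 mn) => [/andP[s0 sm] nE _ _|sm pE nE lE].
  by apply/ltnW/leq_steps => //; lia.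
rewrite pE mulnS add2n; apply: leq_steps => //.
rewrite !(mulSn, mulnDl) ?pE in nE lE *.
rewrite mulSn in nE; lia.
Qed.

(** * The program *)

(* Evaluation without the word bound. *)
Fixpoint value (s : state) (a : expr) : nat :=
  match a with
  | Const x => x
  | Reg r => regs s r
  | Fetch b => memory s (value s b)
  | Bin o b c => binop_eval o (value s b) (value s c)
  end.

(* The constants are bounded so that they do not exceed a base B > 1 in the
   estimate B ^ cost a of the value of a. *)
Fixpoint pure_expr (a : expr) : bool :=
  match a with
  | Const x => x <= 2
  | Reg _ => true
  | Fetch _ => false
  | Bin _ b c => pure_expr b && pure_expr c
  end.

Lemma value_le B s a : 1 < B -> (forall r, regs s r <= B) -> pure_expr a ->
  value s a <= B ^ cost a.
Proof.
move=> B1 sB; elim: a => //= [x x2|o b IHb c IHc /andP[/IHb b_le /IHc c_le]].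
  by rewrite expn1; lia.
have gt0 a : 0 < B ^ cost a by rewrite expn_gt0; lia.
have B0 := gt0 b; have C0 := gt0 c.
(* Every operation is bounded by 1, the sum or the product; the spare factor [B >= 2] absorbs the
   sum. *)
have : maxn (maxn 1 (value s b + value s c)) (value s b * value s c) <=
    B ^ (cost b + cost c).+1.
  rewrite expnS expnD !geq_max; apply/andP; split; last first.
    by apply: leq_trans (leq_mul b_le c_le) _; rewrite leq_pmull //; lia.
  rewrite !muln_gt0 B0 C0 andbT; apply/andP; split; first by lia.
  apply: leq_trans (leq_mul B1 (leqnn (B ^ cost b * B ^ cost c))).
  have := leq_pmulr (B ^ cost b) C0; have := leq_pmull (B ^ cost c) B0; lia.
have := leq_div (value s b) (value s c).
have := leq_mod (value s b) (value s c).
by case: o => /=; lia.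
Qed.

Lemma eval_value B W s a : 1 < B -> (forall r, regs s r <= B) -> pure_expr a ->
  B ^ cost a < W -> eval W s a = Some (value s a).
Proof.
move=> B1 sB pa aW.
have lt_W b : pure_expr b -> B ^ cost b < W -> value s b < W.
  by move=> pb; apply: leq_ltn_trans (value_le B1 sB pb).
elim: a pa aW => [x|r|b _|o b IHb c IHc] pa //= aW.
- by rewrite /word; have /= -> := lt_W (Const x) pa aW.
- by rewrite /word; have /= -> := lt_W (Reg r) pa aW.
have /andP[pb pc] := pa.
have sub a : cost a <= (cost b + cost c).+1 -> B ^ cost a < W.
  by move=> h; apply: leq_ltn_trans aW; rewrite leq_exp2l.
rewrite IHb ?sub //=; last by lia.
rewrite IHc ?sub //=; last by lia.
by rewrite /word; have /= -> := lt_W (Bin o b c) pa aW.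
Qed.

Lemma value_regs s s' a :
  pure_expr a -> regs s =1 regs s' -> value s a = value s' a.
Proof.
move=> pa ss'; elim: a pa => //= o b IHb c IHc /andP[/IHb -> /IHc ->] //.
Qed.

Definition fill (a : expr) : cmd :=
  While (Bin OLe (Reg 3) (Reg 0))
    (Seq (Store (Reg 3) a) (Assign 3 (Bin OAdd (Reg 3) (Const 1)))).

(** [d] counts the vertices left. A round costs 3 for the test, [cost a + 2] for the store, 4 for
    the increment and 1 for the loop. *)
Lemma fill_exec B W a d s : 1 < B -> (forall r, regs s r <= B) ->
    regs s 0 < B -> pure_expr a -> B ^ (cost a + 3) < W -> regs s 3 + d = (regs s 0).+1 ->
  exists s', exec W (fill a) s (d * (cost a + 10) + 4) s' /\
    forall v, memory s' v =
      if regs s 3 <= v <= regs s 0 then value (set_reg s 3 v) a else memory s v.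
Proof.
move=> B1 + + pa aW.
have ev b s1 : (forall r, regs s1 r <= B) -> pure_expr b ->
    cost b <= cost a + 3 ->
    eval W s1 b = Some (value s1 b).
  move=> s1B pb ba; apply: (eval_value B1 s1B pb).
  by apply: leq_ltn_trans aW; rewrite leq_exp2l.
elim: d s => [|d IH] s sB nB sd.
  exists s; split; last by move=> v; case: ifP => //; lia.
  apply: (@ExecWhileEnd W (Bin OLe (Reg 3) (Reg 0)) _ s).
  by rewrite ev //=; [congr Some; lia|lia].
pose s1 := set_mem s (regs s 3) (value s a).
pose s2 := set_reg s1 3 (regs s 3 + 1).
have s1B r : regs s1 r <= B by exact: sB.
have s2B r : regs s2 r <= B by rewrite /s2 /=; case: eqP => // _; lia.
have [|s' [s'P memP]] := IH s2 s2B nB; first by rewrite /s2 /=; lia.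
exists s'; split; last first.
  move=> v; rewrite memP {memP}.
  (* As [a] never fetches, earlier stores do not affect its value. *)
  have -> : value (set_reg s2 3 v) a = value (set_reg s 3 v) a.
    by apply: value_regs => // r /=; case: eqP.
  rewrite /s2 /=; case: ifP => h; first by rewrite ifT //; lia.
  case: eqP => [->|ne]; last by rewrite ifF //; lia.
  by rewrite ifT; [apply: value_regs => // r /=; case: eqP => // ->|lia].
have -> : d.+1 * (cost a + 10) + 4 =
    (cost (Bin OLe (Reg 3) (Reg 0)) + (cost (Reg 3) + cost a).+1.+4 +
      (d * (cost a + 10) + 4)).+1 by rewrite mulSn /=; lia.
apply: (ExecWhileStep (x := 1)) s'P => //.
  by rewrite ev //=; [congr Some; lia|lia].
rewrite -[_.+4]addn4; apply: (@ExecSeq _ _ _ _ s1).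
  by apply: ExecStore; rewrite ev //=; lia.
apply: (@ExecAssign _ _ _ (Bin OAdd (Reg 3) (Const 1))).
by rewrite ev //=; lia.
Qed.

(** * The color as a program expression *)

Local Notation "a [+] b" := (Bin OAdd a b) (at level 50, left associativity).
Local Notation "a [-] b" := (Bin OSub a b) (at level 50, left associativity).
Local Notation "a [*] b" := (Bin OMul a b) (at level 40, left associativity).
Local Notation "a [/] b" := (Bin ODiv a b) (at level 40, left associativity).
Local Notation "a [%] b" := (Bin OMod a b) (at level 40, left associativity).
Local Notation "a [<=] b" := (Bin OLe a b) (at level 70).
Local Notation "a [==] b" := (Bin OEq a b) (at level 70).

(** Selection by a test with value 0 or 1 keeps the color a single fetch-free expression, to which
    the bound on values applies. *)
Definition if_expr (c a b : expr) : expr := c [*] a [+] (Const 1 [-] c) [*] b.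

Lemma value_if s c a b (t : bool) : value s c = t ->
  value s (if_expr c a b) = if t then value s a else value s b.
Proof. by rewrite /= => ->; case: t; rewrite ?mul1n ?mul0n ?addn0. Qed.

Section ColorExpr.
Variables M K P Q S L V : expr.

Definition stride_expr T := Const 2 [*] (K [-] T) [-] Const 1.
Definition asc_len_expr := Const 2 [*] P [*] (K [-] P).
Definition desc_len_expr := Q [*] stride_expr Q [+] (K [-] Q).
Definition desc_start_expr :=
  asc_len_expr [*] (M [-] S) [+] (S [+] Const 1 [<=] M).
Definition height_expr y := if_expr (S [<=] y) P Q.
Definition block_start_expr y :=
  if_expr (S [<=] y) (asc_len_expr [*] (y [-] S))
    (desc_start_expr [+] (S [-] Const 1 [-] y) [*] desc_len_expr).

Definition lower_expr x y :=
  block_start_expr y [+]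
    (height_expr y [-] Const 1 [-] x [/] M) [*] stride_expr (height_expr y) [+]
    (K [-] height_expr y).
Definition upper_expr x y :=
  block_start_expr y [+] (x [/] M) [*] stride_expr (height_expr y).

Definition color_expr : expr :=
  let lo := L [-] Const 1 [-] V in
  let up := V [-] L [-] Const 1 in
  if_expr (V [+] Const 1 [<=] L) (lower_expr lo (M [-] Const 1 [-] lo [%] M))
    (if_expr (V [==] L) (desc_start_expr [+] S [*] desc_len_expr)
      (upper_expr up (up [%] M))).

Variable s : state.
Local Notation val := (value s).

Lemma value_height y :
  val (height_expr y) = block_height (val P) (val Q) (val S) (val y).
Proof. exact: value_if. Qed.

Lemma value_desc_start :
  val desc_start_expr = desc_start (val M) (val K) (val P) (val S).
Proof.
have ltE : (val S < val M) = (val S + 1 <= val M) by rewrite addn1.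
by rewrite /desc_start ltE.
Qed.

Lemma value_block_start y : val (block_start_expr y) =
  block_start (val M) (val K) (val P) (val Q) (val S) (val y).
Proof.
rewrite (@value_if _ _ _ _ (val S <= val y)) //.
by rewrite /block_start -value_desc_start.
Qed.

Lemma value_lower x y : val (lower_expr x y) =
  let T := block_height (val P) (val Q) (val S) (val y) in
  block_start (val M) (val K) (val P) (val Q) (val S) (val y) +
    (T - 1 - val x %/ val M) * stride (val K) T + (val K - T).
Proof. by rewrite -value_block_start -value_height. Qed.

Lemma value_upper x y : val (upper_expr x y) =
  block_start (val M) (val K) (val P) (val Q) (val S) (val y) +
    (val x %/ val M) *
      stride (val K) (block_height (val P) (val Q) (val S) (val y)).
Proof. by rewrite -value_block_start -value_height. Qed.

Lemma value_color : val color_expr =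
  color (val M) (val K) (val P) (val Q) (val S) (val L) (val V).
Proof.
rewrite /color_expr (@value_if _ _ _ _ (val V < val L)); last first.
  by rewrite /= addn1.
rewrite (@value_if _ _ _ _ (val V == val L)) // value_lower value_upper.
by rewrite /color -value_desc_start.
Qed.

End ColorExpr.

(* If m > n then m can be replaced by n: both graphs are complete. *)
Definition step_expr : expr := Reg 1 [-] (Reg 1 [-] Reg 0).
Definition half_expr : expr :=
  (Reg 0 [+] step_expr [-] Const 1) [/] (Const 2 [*] step_expr).
Definition even_expr : expr := Const 2 [*] step_expr [*] half_expr.
Definition short_expr : expr := (Reg 0 [-] even_expr) [+] (even_expr [-] Reg 0).
Definition short_height_expr : expr := half_expr [-] (Reg 0 [<=] even_expr).
Definition center_expr : expr := (Reg 0 [-] short_expr) [/] Const 2.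

Definition label_expr : expr :=
  color_expr step_expr (Reg 2) half_expr short_height_expr short_expr
    center_expr (Reg 3).

Lemma value_label s n m k v :
    regs s 0 = n -> regs s 1 = m -> regs s 2 = k -> regs s 3 = v ->
  value s label_expr =
    let M := minn m n in
    color M k (half_blocks n M) (short_height n M) (short_classes n M)
      (center n M) v.
Proof.
move=> r0 r1 r2 r3; rewrite /label_expr value_color.
have stepE : value s step_expr = minn m n by rewrite /= r0 r1; lia.
have halfE : value s half_expr = half_blocks n (minn m n).
  by rewrite -stepE -r0.
have evenE : value s even_expr = 2 * minn m n * half_blocks n (minn m n).
  by rewrite -halfE -stepE.
have shortE : value s short_expr = short_classes n (minn m n).
  by rewrite /short_classes -evenE -r0.
have heightE : value s short_height_expr = short_height n (minn m n).
  by rewrite /short_height -evenE -halfE -r0.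
have centerE : value s center_expr = center n (minn m n).
  by rewrite /center -shortE -r0.
by rewrite stepE halfE shortE heightE centerE /= r2 r3.
Qed.

(* The color of the vertex v is output in memory cell v.  The word bound is
   that of the word RAM: words of O(log (n + m + k)) bits. *)
Theorem theorem1p9 :
  exists (p : cmd) (c C : nat), forall n m k : nat,
    0 < n -> 0 < m -> 0 < k -> diam (@path_power n m) < k ->
    exists (t : nat) (s : state),
      [/\ exec ((n + m + k) ^ c) p (input n m k) t s,
          t <= C * n &
          optimal_radio_coloring (@path_power n m) k
            (fun v : 'I_n.+1 => memory s v)].
Proof.
(* Hiding the large expression behind its specification keeps [cost a] opaque. *)
have [a [pa aE]] : exists a, pure_expr a /\ forall s n m k v,
    regs s 0 = n -> regs s 1 = m -> regs s 2 = k -> regs s 3 = v ->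
    value s a = let M := minn m n in
      color M k (half_blocks n M) (short_height n M) (short_classes n M)
        (center n M) v.
  by exists label_expr; split=> //; exact: value_label.
(* The exponent exceeds that in [fill_exec] by one to make the word bound strict; as [n > 0], the
   doubling in [C] pays for the round of vertex [n] and its 4 for the final test. *)
exists (fill a), (cost a + 4), (2 * (cost a + 10) + 4).
move=> n m k n0 m0 k0 diam_lt.
have M0 : 0 < minn m n by lia.
have Mn : minn m n <= n by lia.
have gdistE u v : gdist (@path_power n m) u v = steps (minn m n) u v.
  by rewrite gdist_path_power // (steps_minn m0 n0) // -ltnS.
have k_gt := diam_gt_blocks gdistE M0 Mn diam_lt.
have [|||||s [s_exec s_mem]] :=
    @fill_exec (n + m + k) ((n + m + k) ^ (cost a + 4)) a n.+1 (input n m k)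
      _ _ _ pa _ _.
- by lia.
- by case=> [|[|[|r]]] /=; lia.
- by rewrite /=; lia.
- by rewrite ltn_exp2l; lia.
- by [].
exists (n.+1 * (cost a + 10) + 4), s; split=> //.
  by move: (cost a) => c; nia.
have [radio sp] := color_optimal M0 (layoutP M0 Mn) k_gt gdistE Mn.
have memE (v : 'I_n.+1) : memory s v =
    color (minn m n) k (half_blocks n (minn m n)) (short_height n (minn m n))
      (short_classes n (minn m n)) (center n (minn m n)) v.
  by rewrite s_mem /= -ltnS ltn_ord; apply: aE.
split; last by rewrite -sp; apply: eq_bigr => v _; rewrite memE.
apply/forallP => u; apply/forallP => v; rewrite !memE.
by move/forallP: radio => /(_ u) /forallP /(_ v).
Qed.
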